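(* Consider a nontrivial $m$-cycle of $C$ with local minima $n_1,\dots,n_m$. Let $K$ be the number of odd elements and $L$ the number of even elements of the cycle. Then $\delta<\frac{K+L}{K}<\delta+\frac{1}{K\cdot 3\cdot\log(2)}\cdot\sum_{i=1}^m T(n_i).$
   Context: $C(n)=n/2$ for even $n$, $C(n)=(3n+1)/2$ for odd $n$ (on positive integers); $C^t$ is the $t$-fold iterate. A nontrivial cycle is a set $\{n,C(n),\dots,C^{p-1}(n)\}$ with $C^p(n)=n$, different from $\{1,2\}$. A local minimum of the cycle is an element smaller than its predecessor and successor along the cycle (equivalently, an odd element whose predecessor is even). An $m$-cycle is a nontrivial cycle with exactly $m$ local minima, listed as $n_1,\dots,n_m$ in order of appearance along the cycle. For each $i$, $k_i\geq1$ is such that $n_i,C(n_i),\dots,C^{k_i-1}(n_i)$ are odd and $C^{k_i}(n_i)$ is even. Define $T(n_i):=\sum_{t=0}^{k_i-1}\frac{1}{C^t(n_i)}$. $\delta:=\frac{\log 3}{\log 2}$. *)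

(* Defs.v *)
From HB Require Import structures.
From mathcomp Require Import all_boot all_order all_algebra.
From mathcomp Require Import finmap reals exp.

Set Implicit Arguments.
Unset Strict Implicit.
Unset Printing Implicit Defensive.

Import Order.TTheory GRing.Theory Num.Theory.

Local Open Scope nat_scope.
Local Open Scope fset_scope.

(* The map is meant on positive integers, which it preserves; positivity is
   imposed in [is_cycle], excluding the spurious fixed point 0. *)
Definition collatz (n : nat) : nat :=
  if odd n then (3 * n + 1)./2 else n./2.

Definition is_cycle (cyc : {fset nat}) : Prop :=
  exists n p : nat, [/\ 0 < n, 0 < p, iter p collatz n = n
    & cyc = [fset iter t collatz n | t in iota 0 p]].

Definition nontrivial_cycle (cyc : {fset nat}) : Prop :=
  is_cycle cyc /\ cyc <> [fset 1; 2].

(* The successor of x along cyc is [collatz x]; its predecessor is the unique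
   y in cyc with [collatz y = x]. *)
Definition local_min (cyc : {fset nat}) (x : nat) : bool :=
  (x < collatz x) && all (fun y => (collatz y == x) ==> (x < y)) cyc.

Definition local_minima (cyc : {fset nat}) : {fset nat} :=
  [fset x in cyc | local_min cyc x].

Definition mcycle (m : nat) (cyc : {fset nat}) : Prop :=
  nontrivial_cycle cyc /\ #|` local_minima cyc| = m.

(* Starting from x in cyc, the first #|` cyc| iterates run through cyc exactly once;
   the starting point, hence the choice of the first local minimum, is free. *)
Definition lists_local_minima (cyc : {fset nat}) (s : seq nat) : Prop :=
  exists2 x, x \in cyc
    & s = [seq y <- traject collatz x #|` cyc| | y \in local_minima cyc].

Definition odd_run (n k : nat) : Prop :=
  [/\ 1 <= k, forall t, t < k -> odd (iter t collatz n)
    & ~~ odd (iter k collatz n)].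

Definition num_odd (cyc : {fset nat}) : nat := #|` [fset x in cyc | odd x]|.
Definition num_even (cyc : {fset nat}) : nat := #|` [fset x in cyc | ~~ odd x]|.

Local Open Scope ring_scope.

(* k is the length of the run of odd iterates at n, see [odd_run]. *)
Definition T (R : realType) (n k : nat) : R :=
  \sum_(0 <= t < k) 1 / (iter t collatz n)%:R.

Definition delta (R : realType) : R := ln 3 / ln 2.

(* Main.v *)
(** Since the map permutes the cycle, the logarithms of [C x / x] sum to zero
    along it. This factor is [1 / 2] for even [x] and [3 / 2 * (1 + 1 / (3 x))]
    for odd [x], so [(K + L) ln 2 - K ln 3] is the sum over the odd elements of
    [ln (1 + 1 / (3 x))], each term lying strictly between [0] and [1 / (3 x)].
    Finally, going backwards from an odd element through odd elements decreases,
    hence stops at a local minimum: every odd element lies in one of the odd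
    runs, and the sum of the reciprocals is at most the sum of the [T n_i]. *)

Require Import Defs.
From HB Require Import structures.
From mathcomp Require Import all_boot all_order all_algebra.
From mathcomp Require Import finmap reals exp.
From mathcomp Require Import zify ring lra.

Set Implicit Arguments.
Unset Strict Implicit.
Unset Printing Implicit Defensive.

Import Order.TTheory GRing.Theory Num.Theory.
Local Open Scope ring_scope.

Section CollatzMap.
Local Open Scope nat_scope.

Lemma collatz_odd_double (x : nat) : odd x -> (collatz x).*2 = 3 * x + 1.
Proof. by rewrite /collatz => xo; rewrite xo; lia. Qed.

Lemma collatz_even_double (x : nat) : ~~ odd x -> (collatz x).*2 = x.
Proof. by rewrite /collatz => /negbTE xe; rewrite xe; lia. Qed.

Lemma odd_lt_collatz (x : nat) : odd x -> x < collatz x.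
Proof. by move=> xo; have := collatz_odd_double xo; lia. Qed.

Lemma collatz_gt0 (x : nat) : 0 < x -> 0 < collatz x.
Proof.
move=> x0; case: (boolP (odd x)) => [xo|xe].
  by have := odd_lt_collatz xo; lia.
by have := collatz_even_double xe; lia.
Qed.

End CollatzMap.

Section Cycle.
Local Open Scope nat_scope.
Variable cyc : {fset nat}.
Hypothesis cycP : is_cycle cyc.

Lemma cycle_gt0 (x : nat) : x \in cyc -> 0 < x.
Proof.
case: cycP => n [p [n0 _ _ ->]] /imfsetP[t _ ->].
by elim: t => //= t; exact: collatz_gt0.
Qed.

Lemma cycle_collatz (x : nat) : x \in cyc -> collatz x \in cyc.
Proof.
case: cycP => n [p [_ p0 np ->]] /imfsetP[t /=]; rewrite mem_iota => /andP[_ tp] ->.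
rewrite add0n in tp; have [tp'|pt] := ltnP t.+1 p.
  by apply/imfsetP; exists t.+1; rewrite //= mem_iota.
have -> : collatz (iter t collatz n) = iter 0 collatz n.
  by rewrite -iterS (_ : t.+1 = p) //; lia.
by apply/imfsetP; exists 0; rewrite //= mem_iota.
Qed.

Lemma cycle_iter (x t : nat) : x \in cyc -> iter t collatz x \in cyc.
Proof. by move=> xc; elim: t => //= t; exact: cycle_collatz. Qed.

Lemma cycle_connected (x y : nat) :
  x \in cyc -> y \in cyc -> exists t, y = iter t collatz x.
Proof.
case: cycP => n [p [_ p0 np ->]] /imfsetP[a /=]; rewrite mem_iota => /andP[_ ap] ->.
(* From the [a]-th iterate of [n], [p - a] steps close the period and lead back to [n]; [b] more
   reach the target. *)
case/imfsetP => b /= _ ->; exists (b + (p - a)).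
by rewrite -iterD -addnA subnK; [rewrite iterD np | lia].
Qed.

(** Pigeonhole: if the orbit of [x] had not begun to repeat after as many steps as [cyc] has
    elements, one further iterate would give too many distinct elements of [cyc]. *)
Lemma mem_cycle_traject (x y : nat) :
  x \in cyc -> y \in cyc -> y \in traject collatz x #|` cyc|.
Proof.
move=> xc yc; have [t ->] := cycle_connected xc yc.
suff /loopingP : looping collatz x #|` cyc| by [].
rewrite -[looping _ _ _]negbK -looping_uniq; apply/negP => /uniq_leq_size.
move=> /(_ (enum_fset cyc)); rewrite size_traject ltnn => H.
by suff : false by []; apply: H => z /trajectP[i _ ->]; exact: cycle_iter.
Qed.

(** Every [y] in the cycle is the image of the iterate just before the orbit returns to [y].
    Surjectivity on a finite set then rules out repeated images. *)
Lemma perm_map_collatz : perm_eq (map collatz cyc) cyc.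
Proof.
have surj : {subset enum_fset cyc <= map collatz cyc}.
  move=> y yc; have [t] := cycle_connected (cycle_collatz yc) yc.
  by rewrite -iterSr iterS => yE; rewrite yE map_f // cycle_iter.
have sub : map collatz cyc =i enum_fset cyc.
  move=> y; apply/idP/idP => [/mapP[x xc ->]|]; [exact: cycle_collatz|exact: surj].
apply: uniq_perm => //; last exact: fset_uniq.
by rewrite (leq_size_uniq (fset_uniq cyc)) // ?size_map.
Qed.

(** Strong induction on [x]: unless [x] is itself a local minimum, it has a smaller odd predecessor,
    whose run extends by one step to [x]. *)
Lemma odd_reached_from_local_min (x : nat) : x \in cyc -> odd x ->
  exists2 z, z \in local_minima cyc &
    exists2 t, x = iter t collatz z & forall s, s <= t -> odd (iter s collatz z).
Proof.
elim/ltn_ind: x => x IH xc xo; have xlt := odd_lt_collatz xo.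
have [xm|] := boolP (local_min cyc x).
  exists x; first by rewrite !inE /= xc.
  by exists 0 => // s; rewrite leqn0 => /eqP->.
rewrite /local_min xlt /= => /allPn[y yc]; rewrite negb_imply -leqNgt.
case/andP => /eqP yx lt_yx.
have yo : odd y.
  (* An even predecessor would be [2 * x], which exceeds [x] since [x] is positive. *)
  apply: contraT => ye; have := collatz_even_double ye; have := cycle_gt0 xc; lia.
have {}lt_yx : y < x by rewrite -yx odd_lt_collatz.
have [z zm [t yE todd]] := IH y lt_yx yc yo.
exists z => //; exists t.+1; first by rewrite iterS -yE yx.
by move=> s; rewrite leq_eqVlt => /orP[/eqP->|/todd//]; rewrite iterS -yE yx.
Qed.

(** Halving at every step would decrease strictly and never return to [n]. This makes the division
    by [K] meaningful and the sums over odd elements nonempty. *)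
Lemma has_odd_cycle : has odd cyc.
Proof.
apply: contraT => /hasPn alleven; case: (cycP) => n [p [n0 p0 np cE]].
have nc : n \in cyc by rewrite cE; apply/imfsetP; exists 0; rewrite //= mem_iota.
have : iter p collatz n < n; last by rewrite np ltnn.
case: p p0 {np cE} => // p _; elim: p => [|p IHp].
  by have := collatz_even_double (alleven _ nc); rewrite /=; lia.
apply: leq_ltn_trans IHp; rewrite iterS.
by have := collatz_even_double (alleven _ (cycle_iter p.+1 nc)); lia.
Qed.

End Cycle.

Lemma num_oddE (cyc : {fset nat}) : num_odd cyc = count odd cyc.
Proof.
rewrite /num_odd -size_filter; apply: perm_size; apply: uniq_perm.
- exact: fset_uniq.
- by rewrite filter_uniq.
by move=> x; rewrite mem_filter !inE /= andbC.
Qed.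

Lemma num_evenE (cyc : {fset nat}) : num_even cyc = count (predC odd) cyc.
Proof.
rewrite /num_even -size_filter; apply: perm_size; apply: uniq_perm.
- exact: fset_uniq.
- by rewrite filter_uniq.
by move=> x; rewrite mem_filter !inE /= andbC.
Qed.

Section Logarithms.
Variable R : realType.

Lemma ln_collatz (x : nat) : (0 < x)%N ->
  ln (collatz x)%:R = ln x%:R - ln 2
    + (if odd x then ln 3 + ln (1 + (3 * x%:R)^-1) else 0) :> R.
Proof.
move=> x0; have xR : (0 : R) < x%:R by rewrite ltr0n.
have cR : (0 : R) < (collatz x)%:R by rewrite ltr0n collatz_gt0.
have dbl : ln (collatz x).*2%:R = ln 2 + ln (collatz x)%:R :> R.
  by rewrite -mul2n natrM lnM // posrE.
case: (boolP (odd x)) => [xo|xe]; last first.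
  by rewrite collatz_even_double // in dbl; lra.
have p1 : 0 < 1 + (3 * x%:R)^-1 :> R by rewrite addr_gt0 // invr_gt0 mulr_gt0.
rewrite collatz_odd_double // in dbl.
have e : (3 * x + 1)%:R = 3 * x%:R * (1 + (3 * x%:R)^-1) :> R.
  by rewrite natrD natrM; field; rewrite gt_eqF.
rewrite e lnM ?posrE ?mulr_gt0 // lnM ?posrE // in dbl.
lra.
Qed.

Lemma cycle_log_balance (cyc : {fset nat}) : is_cycle cyc ->
  (num_odd cyc + num_even cyc)%:R * ln 2 = (num_odd cyc)%:R * ln 3
    + \sum_(x <- cyc | odd x) ln (1 + (3 * x%:R)^-1) :> R.
Proof.
move=> cycP; rewrite num_oddE num_evenE count_predC.
have := perm_big _ (perm_map_collatz cycP) :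
  \sum_(x <- map collatz cyc) ln x%:R = \sum_(x <- cyc) ln x%:R :> R.
rewrite big_map (eq_big_seq _ (fun x xc => ln_collatz (cycle_gt0 cycP xc))).
rewrite big_split -big_mkcond /= !big_split /= sumrN.
have sum_const (P : pred nat) (c : R) :
  \sum_(x <- cyc | P x) c = (count P cyc)%:R * c.
  by rewrite big_const_seq iter_addr_0 mulr_natl.
rewrite !sum_const count_predT.
set S := \sum_(x <- cyc | odd x) _.
(* [A], the sum of all [ln x], occurs on both sides and cancels. *)
move: (\sum_(x <- cyc) _) S => A S; move: (_ * ln 2) (_ * ln 3) => b c.
by lra.
Qed.

(** Each entry of [s] is matched with one occurrence in [s'], which is then removed. Since [s'] may
    have repetitions, the odd runs need not be shown disjoint. *)
Lemma ler_sum_subset (I : eqType) (s s' : seq I) (F : I -> R) :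
  (forall i, 0 <= F i) -> uniq s -> {subset s <= s'} ->
  \sum_(i <- s) F i <= \sum_(i <- s') F i.
Proof.
move=> F0; elim: s s' => [|x s IHs] s' /=; first by rewrite big_nil sumr_ge0.
case/andP => xs us sub; rewrite big_cons.
rewrite [leRHS](big_rem _ (sub x (mem_head _ _))) /=.
rewrite lerD2l IHs // => y ys.
have : y \in s' by rewrite sub // inE ys orbT.
rewrite (perm_mem (perm_to_rem (sub x (mem_head _ _)))) inE.
by case/predU1P => // yx; rewrite -yx ys in xs.
Qed.

Lemma sum_odd_inv_le (m : nat) (cyc : {fset nat}) (n : m.-tuple nat)
    (k : 'I_m -> nat) :
  is_cycle cyc -> lists_local_minima cyc n ->
  (forall i, odd_run (tnth n i) (k i)) ->
  \sum_(x <- cyc | odd x) x%:R^-1 <= \sum_(i < m) T R (tnth n i) (k i).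
Proof.
move=> cycP [x0 x0c nE] kP.
pose runs :=
  [seq iter t collatz (tnth n i) | i <- index_enum 'I_m, t <- iota 0 (k i)].
have -> : \sum_(i < m) T R (tnth n i) (k i) = \sum_(x <- runs) x%:R^-1.
  rewrite big_allpairs_dep /=; apply: eq_bigr => i _.
  by rewrite /T /index_iota subn0; apply: eq_bigr => t _; rewrite div1r.
rewrite -big_filter; apply: ler_sum_subset => [x||x].
- by rewrite invr_ge0.
- by rewrite filter_uniq.
rewrite mem_filter => /andP[xo xc].
have [z zm [t xE todd]] := odd_reached_from_local_min cycP xc xo.
have zc : z \in cyc by move: zm; rewrite !inE => /andP[].
have /tnthP[i zi] : z \in tval n by rewrite nE mem_filter zm mem_cycle_traject.
apply/allpairsPdep; exists i, t; rewrite -zi mem_index_enum mem_iota.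
(* The iterates of [z] up to index [t] are odd while the one at index [k i] is even, so
   [t < k i]. *)
split => //=; rewrite add0n ltnNge; apply/negP => /todd.
by case: (kP i) => _ _; rewrite -zi => /negP.
Qed.

Lemma ln1D_inv_bounds (x : nat) : odd x ->
  0 < ln (1 + (3 * x%:R)^-1) :> R /\
  ln (1 + (3 * x%:R)^-1) < 3^-1 * x%:R^-1 :> R.
Proof.
(* Oddness serves to exclude [0], whose inverse is [0] by convention. The upper bound below is
   [1 + y < expR y] for nonzero [y]. *)
case: x => // x _; have y0 : 0 < (3 * x.+1%:R)^-1 :> R.
  by rewrite invr_gt0 mulr_gt0.
split; first by rewrite ln_gt0 // ltrDl.
rewrite -invfM -ltr_expR lnK ?expR_gt1Dx ?gt_eqF //.
by rewrite posrE addr_gt0.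
Qed.

End Logarithms.

Theorem theorem16 (R : realType) (m : nat) (cyc : {fset nat})
    (n : m.-tuple nat) (k : 'I_m -> nat) (K L : nat)
    (Hcyc : mcycle m cyc) (Hmin : lists_local_minima cyc n)
    (Hk : forall i : 'I_m, odd_run (tnth n i) (k i))
    (HK : K = num_odd cyc) (HL : L = num_even cyc) :
  delta R < (K + L)%:R / K%:R <
    delta R + 1 / (K%:R * 3 * ln 2) * \sum_(i < m) T R (tnth n i) (k i).
Proof.
have cycP : is_cycle cyc by case: Hcyc => -[].
have hasodd := has_odd_cycle cycP.
have balance := cycle_log_balance R cycP.
have K0 : 0 < K%:R :> R by rewrite ltr0n HK num_oddE -has_count.
have l2 : 0 < ln 2 :> R by rewrite ln_gt0 // ltr1n.
rewrite -HK -HL in balance; rewrite /delta.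
set S := \sum_(x <- cyc | odd x) _ in balance.
(* Strictness of this sum and of the next bound relies on [hasodd]. *)
have S0 : 0 < S.
  apply: le_lt_trans (_ : \sum_(x <- cyc | odd x) 0 < S); first by rewrite big1.
  by apply: ltr_sum => // x /(ln1D_inv_bounds R)[].
have Sub : S < 3^-1 * \sum_(i < m) T R (tnth n i) (k i).
  apply: lt_le_trans (_ : 3^-1 * \sum_(x <- cyc | odd x) x%:R^-1 <= _).
    by rewrite mulr_sumr; apply: ltr_sum => // x /(ln1D_inv_bounds R)[].
  by apply: ler_wpM2l; [rewrite invr_ge0 | exact: sum_odd_inv_le].
(* This is [balance] divided by [K * ln 2]; both inequalities now reduce to the bounds on [S]. *)
have -> : (K + L)%:R / K%:R = ln 3 / ln 2 + S / (K%:R * ln 2) :> R.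
  rewrite -[(K + L)%:R](mulfK (lt0r_neq0 l2)) balance.
  by field; rewrite !gt_eqF.
rewrite ltrDl divr_gt0 ?mulr_gt0 //= ltrD2l.
rewrite [ltRHS](_ : _ =
  (3^-1 * \sum_(i < m) T R (tnth n i) (k i)) / (K%:R * ln 2)); last first.
  by field; rewrite !gt_eqF.
by rewrite ltr_pM2r // invr_gt0 mulr_gt0.
Qed.
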